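(* Let $K$ be a field of characteristic $2$ and let $G$ be a finite non-abelian $2$-group whose derived subgroup $G'$ is cyclic. Suppose there exists an element $z$ of order $2$ in $Z(G)\setminus G'$, where $Z(G)$ is the center of $G$. Then the wreath product $C_2 \wr G'$ of the cyclic group $C_2$ of order $2$ and the derived subgroup $G'$ is involved in $V(KG)$; that is, there exist a subgroup $H \le V(KG)$ and a normal subgroup $N \trianglelefteq H$ such that $H/N \cong C_2 \wr G'$.
   Context: $KG$ is the group algebra of $G$ over $K$, and $I(KG)$ is its augmentation ideal (the kernel of the $K$-linear map $KG \to K$ sending every $g\in G$ to $1$). For a finite $p$-group $G$ and a field $K$ of characteristic $p$, the group of normalized units is $V(KG) = \{1+x : x \in I(KG)\}$, a group under multiplication in $KG$. A group $W$ is involved in $V(KG)$ (is a section of $V(KG)$) if it is isomorphic to a factor group of some subgroup of $V(KG)$. The wreath product $C_2 \wr G'$ is the regular wreath product: the semidirect product $B \rtimes G'$, where the base group $B = \prod_{g \in G'} C_2$ is the direct product of $|G'|$ copies of $C_2$ indexed by the elements of $G'$, and $G'$ acts on $B$ by permuting the coordinates via its regular action on itself. *)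

(* Defs.v *)
From HB Require Import structures.
From mathcomp Require Import all_boot all_order all_fingroup all_algebra.
From mathcomp Require Import all_solvable all_field all_character.

Set Implicit Arguments.
Unset Strict Implicit.
Unset Printing Implicit Defensive.

Import GRing.Theory.

(* The group algebra KG: functions gT -> K with the convolution product; the
   function x stands for the formal sum \sum_g x g *: g.  K^o is K as a module
   over itself, so that the vector space structure is the pointwise one. *)
Section GroupAlgebra.

Local Open Scope ring_scope.

Variables (K : fieldType) (gT : finGroupType).

Definition grpAlg : predArgType := {ffun gT -> K^o}.

HB.instance Definition _ := Vector.copy grpAlg {ffun gT -> K^o}.

Implicit Types (x y z : grpAlg) (g h : gT).

Definition grpAlg_of (g : gT) : grpAlg := [ffun h => (h == g)%:R].

Definition grpAlg_mul x y : grpAlg :=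
  [ffun g => \sum_h (x h : K) * y (h^-1 * g)%g].

Lemma addgE x y g : (x + y) g = x g + y g.
Proof. by rewrite ffunE. Qed.

Lemma scalegE (a : K) x g : (a *: x) g = a * x g.
Proof. by rewrite ffunE. Qed.

Lemma grpAlg_mulA : associative grpAlg_mul.
Proof.
move=> x y z; apply/ffunP=> g; rewrite !ffunE.
under eq_bigr => h _ do rewrite ffunE mulr_sumr.
under [RHS]eq_bigr => h _ do rewrite ffunE mulr_suml.
rewrite [RHS]exchange_big /=; apply: eq_bigr => h _.
rewrite [RHS](reindex_inj (mulgI h)) /=; apply: eq_bigr => k _.
by rewrite mulKg invMg mulgA mulrA.
Qed.

Lemma grpAlg_mul1 : left_id (grpAlg_of 1%g) grpAlg_mul.
Proof.
move=> x; apply/ffunP=> g; rewrite ffunE (bigD1 1%g) //= ffunE eqxx mul1r.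
rewrite invg1 mul1g big1 ?addr0 // => h /negbTE h1.
by rewrite ffunE h1 mul0r.
Qed.

Lemma grpAlg_mulr1 : right_id (grpAlg_of 1%g) grpAlg_mul.
Proof.
move=> x; apply/ffunP=> g; rewrite ffunE (bigD1 g) //= ffunE mulVg eqxx mulr1.
rewrite big1 ?addr0 // => h hg.
by rewrite ffunE -eq_mulVg1 (negbTE hg) mulr0.
Qed.

Lemma grpAlg_mulDl : left_distributive grpAlg_mul +%R.
Proof.
move=> x y z; apply/ffunP=> g; rewrite !ffunE -big_split /=.
by apply: eq_bigr => h _; rewrite ffunE mulrDl.
Qed.

Lemma grpAlg_mulDr : right_distributive grpAlg_mul +%R.
Proof.
move=> x y z; apply/ffunP=> g; rewrite !ffunE -big_split /=.
by apply: eq_bigr => h _; rewrite ffunE mulrDr.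
Qed.

Lemma grpAlg_oner_neq0 : grpAlg_of 1%g != 0.
Proof.
apply/eqP=> /ffunP/(_ 1%g)/eqP; rewrite !ffunE eqxx.
by rewrite (oner_eq0 K).
Qed.

HB.instance Definition _ := GRing.Zmodule_isNzRing.Build grpAlg
  grpAlg_mulA grpAlg_mul1 grpAlg_mulr1 grpAlg_mulDl grpAlg_mulDr
  grpAlg_oner_neq0.

Lemma mulgE x y g : (x * y) g = \sum_h (x h : K) * y (h^-1 * g)%g.
Proof. by rewrite ffunE. Qed.

Lemma grpAlg_scaleAl (a : K) x y : a *: (x * y) = (a *: x) * y.
Proof.
apply/ffunP=> g; rewrite scalegE !mulgE mulr_sumr.
by apply: eq_bigr => h _; rewrite scalegE mulrA.
Qed.

HB.instance Definition _ :=
  GRing.Lmodule_isLalgebra.Build K grpAlg grpAlg_scaleAl.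

Lemma grpAlg_scaleAr (a : K) x y : a *: (x * y) = x * (a *: y).
Proof.
apply/ffunP=> g; rewrite scalegE !mulgE mulr_sumr.
by apply: eq_bigr => h _; rewrite scalegE mulrCA.
Qed.

HB.instance Definition _ :=
  GRing.Lalgebra_isAlgebra.Build K grpAlg grpAlg_scaleAr.

HB.instance Definition _ := Algebra_isFalgebra.Build K grpAlg.

Lemma grpAlg_ofM g h : grpAlg_of (g * h) = grpAlg_of g * grpAlg_of h.
Proof.
apply/ffunP=> k; rewrite mulgE (bigD1 g) //= big1 => [|l /negbTE lg].
  rewrite !ffunE eqxx mul1r addr0; congr (_%:R).
  by rewrite -(inj_eq (mulgI g^-1%g)) mulKg.
by rewrite ffunE lg mul0r.
Qed.

Lemma grpAlg_of1 : grpAlg_of 1 = 1.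
Proof. by []. Qed.

Lemma grpAlg_sum x : x = \sum_g x g *: grpAlg_of g.
Proof.
apply/ffunP=> h; rewrite sum_ffunE (bigD1 h) //= big1 => [|g].
  by rewrite !ffunE eqxx addr0 [RHS]mulr1.
by rewrite !ffunE eq_sym => /negbTE->; rewrite [LHS]mulr0.
Qed.

Definition augmentation (x : grpAlg) : K^o := \sum_g x g.

Lemma augmentation_is_linear : linear augmentation.
Proof.
move=> a x y; rewrite /augmentation scaler_sumr -big_split /=.
by apply: eq_bigr => g _; rewrite addgE scalegE.
Qed.

HB.instance Definition _ :=
  GRing.isLinear.Build K grpAlg K^o *:%R augmentation augmentation_is_linear.

Lemma augmentation_of g : augmentation (grpAlg_of g) = 1.
Proof.
rewrite /augmentation (bigD1 g) //= big1 => [|h /negbTE hg].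
  by rewrite ffunE eqxx addr0.
by rewrite ffunE hg.
Qed.

Lemma augmentationM x y :
  augmentation (x * y) = (augmentation x : K) * augmentation y.
Proof.
rewrite /augmentation; under eq_bigr do rewrite mulgE.
rewrite exchange_big mulr_suml /=; apply: eq_bigr => h _.
rewrite -mulr_sumr; congr (_ * _).
by rewrite (reindex_inj (mulgI h)); under eq_bigr do rewrite mulKg.
Qed.

Lemma augmentation1 : augmentation 1 = 1.
Proof. exact: augmentation_of. Qed.

Definition augIdeal : {vspace grpAlg} := lker (linfun augmentation).

Lemma mem_augIdeal x : (x \in augIdeal) = (augmentation x == 0).
Proof. by rewrite memv_ker lfunE. Qed.

End GroupAlgebra.

Section PGroupUnits.

Local Open Scope ring_scope.

Variables (K : fieldType) (gT : finGroupType) (p : nat).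
Hypotheses (charK : p \in [pchar K]) (pG : (p.-group [set: gT])%g).

Let A := grpAlg K gT.
Let n := dim (A : vectType K).

Import VectorInternalTheory.

Let toV (x : A) : 'rV[K]_n := v2r x.
Let toA (v : 'rV[K]_n) : A := @r2v K A v.

Let toVK : cancel toV toA.
Proof. exact: v2rK. Qed.

Let toAK : cancel toA toV.
Proof. exact: r2vK. Qed.

Let toV_linear : linear toV.
Proof. by move=> a u v; exact: (linearP (@v2r K A)). Qed.

Let toA_linear : linear toA.
Proof. by move=> a u v; exact: (linearP (@r2v K A)). Qed.

Let toV0 : toV 0 = 0.
Proof. exact: (linear0 (@v2r K A)). Qed.

Let toA0 : toA 0 = 0.
Proof. exact: (linear0 (@r2v K A)). Qed.

Let mulr_mx (x : A) (v : 'rV[K]_n) : 'rV[K]_n := toV ((toA v) * x).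
Let mull_mx (x : A) (v : 'rV[K]_n) : 'rV[K]_n := toV (x * (toA v)).

Let mulr_mx_linear x : linear (mulr_mx x).
Proof.
by move=> a u v; rewrite /mulr_mx toA_linear mulrDl -scalerAl toV_linear.
Qed.

Let mull_mx_linear x : linear (mull_mx x).
Proof.
by move=> a u v; rewrite /mull_mx toA_linear mulrDr -scalerAr toV_linear.
Qed.

Let mxr (x : A) : 'M[K]_n := lin1_mx (mulr_mx x).
Let mxl (x : A) : 'M[K]_n := lin1_mx (mull_mx x).

Let mxrE x (v : 'rV_n) : v *m mxr x = toV ((toA v) * x).
Proof.
pose f : {linear 'rV[K]_n -> 'rV[K]_n} := HB.pack (mulr_mx x)
  (GRing.isLinear.Build K _ _ *:%R _ (mulr_mx_linear x)).
exact: (mul_rV_lin1 f).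
Qed.

Let mxlE x (v : 'rV_n) : v *m mxl x = toV (x * (toA v)).
Proof.
pose f : {linear 'rV[K]_n -> 'rV[K]_n} := HB.pack (mull_mx x)
  (GRing.isLinear.Build K _ _ *:%R _ (mull_mx_linear x)).
exact: (mul_rV_lin1 f).
Qed.

Let rG_repr : mx_repr [set: gT] (fun g => mxr (grpAlg_of K g)).
Proof.
split=> [|g h _ _]; apply/row_matrixP=> i; rewrite !rowE.
  by rewrite mxrE grpAlg_of1 mulr1 toAK mulmx1.
by rewrite mulmxA !mxrE toVK grpAlg_ofM mulrA.
Qed.

Let rG := MxRepresentation rG_repr.

Let mxl_cent x : centgmx rG (mxl x).
Proof.
apply/centgmxP=> g _; apply/row_matrixP=> i; rewrite !rowE !mulmxA.
by rewrite /= !(mxrE, mxlE) !toVK mulrA.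
Qed.

Let aug_inj (x y : A) : augmentation x != 0 -> x * y = 0 -> y = 0.
Proof.
move=> ax xy0; apply/eqP; apply: contraT => y0.
have Umod := kermx_centg_module (mxl_cent x).
have Upos : (0 < \rank (kermx (mxl x)))%N.
  rewrite lt0n mxrank_eq0; apply: contraNneq y0 => k0.
  have: (toV y <= kermx (mxl x))%MS.
    by apply/sub_kermxP; rewrite mxlE toVK xy0 toV0.
  by rewrite k0 submx0 => /eqP y0; rewrite -[y]toVK y0 toA0.
have := rfix_pgroup_char charK (submod_repr Umod) Upos pG.
rewrite -mxrank_eq0 (rfix_submod Umod (subxx _)) mxrank_in_submod ?capmxSl //.
rewrite mxrank_eq0 => /(_ (subxx _)) /rowV0Pn[v].
rewrite sub_capmx => /andP[/sub_kermxP vk /rfix_mxP vfix] v0.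
pose w : A := toA v.
have xw0 : x * w = 0 by apply: (can_inj toVK); rewrite -mxlE vk toV0.
have wfix g : w * grpAlg_of K g = w.
  by apply: (can_inj toVK); rewrite -mxrE [LHS]vfix ?inE // toAK.
have wE g : w g = w 1%g.
  rewrite -{1}(wfix g) mulgE (bigD1 1%g) //= big1 => [|h h1].
    by rewrite ffunE invg1 mul1g eqxx mulr1 addr0.
  rewrite ffunE -(inj_eq (mulgI h)) mulKVg -{1}[g]mul1g (inj_eq (mulIg g)).
  by rewrite eq_sym (negbTE h1) mulr0.
suff w0 : w = 0 by case/eqP: v0; rewrite -[v]toAK -/w w0 toV0.
have w1 : w 1%g = 0.
  move/ffunP/(_ 1%g): xw0; rewrite mulgE ffunE.
  under eq_bigr => h _ do rewrite wE.
  rewrite -mulr_suml => /eqP; rewrite mulf_eq0 => /orP[/idPn|/eqP//].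
  by rewrite ax.
by apply/ffunP=> g; rewrite wE w1 ffunE.
Qed.

Let aug_rinv (x : A) : augmentation x != 0 -> exists y, x * y = 1.
Proof.
move=> ax; have k0 : lker (amull x) == 0%VS.
  apply/eqP/vspaceP=> y; rewrite memv_ker lfunE memv0.
  by apply/eqP/eqP=> [/(aug_inj ax)//|->]; rewrite /= mulr0.
by exists ((amull x)^-1%VF 1); have := lker0_lfunVK k0 1; rewrite lfunE.
Qed.

Lemma unit_augmentation (x : A) : augmentation x != 0 -> x \is a GRing.unit.
Proof.
move=> ax; have [y xy1] := aug_rinv ax.
have ay : augmentation y != 0.
  apply: contra_eq_neq (congr1 (@augmentation _ _) xy1) => ay0.
  by rewrite augmentationM ay0 mulr0 augmentation1 eq_sym oner_neq0.
have [z yz1] := aug_rinv ay.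
have xz : x = z by rewrite -[x]mulr1 -yz1 mulrA xy1 mul1r.
by apply/unitrP; exists y; rewrite {1}xz.
Qed.

End PGroupUnits.

(* V(KG) as the group of units of KG lying in 1 + I(KG).  When K has
   characteristic p and G is a p-group the unit condition is redundant: see
   normUnit_pred_pgroup. *)
Section NormalizedUnits.

Local Open Scope ring_scope.

Variables (K : fieldType) (gT : finGroupType).

Definition normUnit_pred : pred (grpAlg K gT) :=
  [pred x | (x - 1 \in augIdeal K gT) && (x \is a GRing.unit)].

Lemma normUnit_pred_pgroup p :
  p \in [pchar K] -> (p.-group [set: gT])%g ->
  forall x, normUnit_pred x = (x - 1 \in augIdeal K gT).
Proof.
move=> charK pG x; rewrite /normUnit_pred inE; apply: andb_idr.
rewrite mem_augIdeal linearB /= augmentation1 subr_eq0 => /eqP ax.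
by apply: (unit_augmentation charK pG); rewrite ax oner_neq0.
Qed.

Definition normUnit : predArgType := {x : grpAlg K gT | normUnit_pred x}.

HB.instance Definition _ := [Choice of normUnit by <:].

Lemma normUnit_predE x :
  normUnit_pred x = (augmentation x == 1) && (x \is a GRing.unit).
Proof.
by rewrite /normUnit_pred inE mem_augIdeal linearB /= augmentation1 subr_eq0.
Qed.

Lemma normUnit_one_subproof : normUnit_pred 1.
Proof. by rewrite normUnit_predE augmentation1 eqxx unitr1. Qed.

Lemma normUnit_mul_subproof (x y : normUnit) : normUnit_pred (val x * val y).
Proof.
case: x y => [x /=] + [y /=]; rewrite !normUnit_predE.
move=> /andP[/eqP ax Ux] /andP[/eqP ay Uy].
by rewrite augmentationM ax ay mulr1 eqxx unitrMl.
Qed.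

Lemma normUnit_inv_subproof (x : normUnit) : normUnit_pred (val x)^-1.
Proof.
case: x => [x /=]; rewrite !normUnit_predE unitrV => /andP[/eqP ax Ux].
have := augmentationM x x^-1.
by rewrite divrr // ax mul1r augmentation1 => <-; rewrite eqxx.
Qed.

Definition normUnit_one : normUnit := Sub 1 normUnit_one_subproof.
Definition normUnit_mul x y : normUnit :=
  Sub (val x * val y) (normUnit_mul_subproof x y).
Definition normUnit_inv x : normUnit :=
  Sub (val x)^-1 (normUnit_inv_subproof x).

Lemma normUnit_mulA : associative normUnit_mul.
Proof. by move=> x y z; apply: val_inj; rewrite /= mulrA. Qed.

Lemma normUnit_mul1 : left_id normUnit_one normUnit_mul.
Proof. by move=> x; apply: val_inj; rewrite /= mul1r. Qed.

Lemma normUnit_mulr1 : right_id normUnit_one normUnit_mul.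
Proof. by move=> x; apply: val_inj; rewrite /= mulr1. Qed.

Lemma normUnit_unit (x : normUnit) : val x \is a GRing.unit.
Proof. by have := valP x; rewrite normUnit_predE => /andP[]. Qed.

Lemma normUnit_mulV : left_inverse normUnit_one normUnit_inv normUnit_mul.
Proof. by move=> x; apply: val_inj; rewrite /= mulVr ?normUnit_unit. Qed.

Lemma normUnit_mulrV : right_inverse normUnit_one normUnit_inv normUnit_mul.
Proof. by move=> x; apply: val_inj; rewrite /= divrr ?normUnit_unit. Qed.

HB.instance Definition _ := isGroup.Build normUnit
  normUnit_mulA normUnit_mul1 normUnit_mulr1 normUnit_mulV normUnit_mulrV.

End NormalizedUnits.

(* The library's quotients of groups are for finite groups only, whereas V(KG)
   is infinite when K is. *)
HB.mixin Record isConjClosed (G : groupType) (N : {pred G}) := {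
  gpredJ_normal : forall x y : G, x \in N -> (x ^ y)%g \in N
}.

#[short(type="normalClosed")]
HB.structure Definition NormalClosed (G : groupType) :=
  {N of isConjClosed G N & GroupClosed G N}.

Section Subgroup.

Local Open Scope group_scope.

Variables (G : groupType) (H : groupClosed G).

Definition subgroup_type : predArgType := {x : G | x \in H}.

HB.instance Definition _ := [isSub of subgroup_type for @sval G _].
HB.instance Definition _ := [Choice of subgroup_type by <:].

Lemma subgroup_closed : group_closed [pred x | x \in H].
Proof. by split=> [|x y]; [exact: gpred1 | exact: gpredF]. Qed.

HB.instance Definition _ :=
  SubChoice_isSubGroup.Build G _ subgroup_type subgroup_closed.

End Subgroup.

Section FactorGroup.

Local Open Scope group_scope.
Local Open Scope quotient_scope.

Variables (G : groupType) (N : normalClosed G).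

Definition coset_rel : rel G := [rel x y | x^-1 * y \in N].

Lemma coset_rel_equiv : equiv_class_of coset_rel.
Proof.
rewrite /coset_rel; split=> [x|x y|y x z] /=; first by rewrite mulVg gpred1.
  by rewrite -gpredV invMg invgK.
by move=> xy yz; rewrite -(mulKVg y z) mulgA gpredM.
Qed.

Canonical coset_equivRel := EquivRelPack coset_rel_equiv.

Definition factor_group : predArgType := {eq_quot coset_rel}.

HB.instance Definition _ := Choice.on factor_group.
HB.instance Definition _ := EqQuotient.on factor_group.

Local Notation rep := generic_quotient.repr.
Local Notation cl := (\pi_factor_group).

Definition factor_one : factor_group := cl 1.
Definition factor_mul (u v : factor_group) : factor_group :=
  cl (rep u * rep v).
Definition factor_inv (u : factor_group) : factor_group := cl (rep u)^-1.

Lemma factor_eqP (x y : G) :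
  reflect (cl x = cl y) (x^-1 * y \in N).
Proof.
by apply: (iffP idP) => [xN|/eqP]; [apply/eqP|];
  rewrite (@eqquotE _ _ factor_group).
Qed.

Lemma factor_piM (x y : G) :
  factor_mul (cl x) (cl y) = cl (x * y).
Proof.
have /factor_eqP xN : cl (rep (cl x)) = cl x.
  exact: generic_quotient.reprK.
have /factor_eqP yN : cl (rep (cl y)) = cl y.
  exact: generic_quotient.reprK.
rewrite /factor_mul; move: (rep _) xN (rep _) yN => a aN b bN.
apply/factor_eqP.
suff -> : (a * b)^-1 * (x * y) = (a^-1 * x) ^ b * (b^-1 * y).
  by rewrite gpredM // gpredJ_normal.
by rewrite /conjg invMg !mulgA mulgK.
Qed.

Lemma factor_piV (x : G) : factor_inv (cl x) = cl x^-1.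
Proof.
have /factor_eqP xN : cl (rep (cl x)) = cl x.
  exact: generic_quotient.reprK.
rewrite /factor_inv; move: (rep _) xN => a aN.
apply/factor_eqP.
suff -> : a^-1^-1 * x^-1 = ((a^-1 * x) ^ a^-1)^-1.
  by rewrite gpredV gpredJ_normal.
by rewrite /conjg !invgK !mulgA mulgV mul1g invMg invgK.
Qed.

Lemma factor_mulA : associative factor_mul.
Proof.
move=> u v w; rewrite -[u]generic_quotient.reprK -[v]generic_quotient.reprK.
rewrite -[w]generic_quotient.reprK.
move: (rep u) (rep v) (rep w) => x y z.
rewrite (factor_piM y z) (factor_piM x y) (factor_piM x (y * z)).
by rewrite (factor_piM (x * y) z) mulgA.
Qed.

Lemma factor_mul1 : left_id factor_one factor_mul.
Proof. by move=> u; rewrite -[u]generic_quotient.reprK factor_piM mul1g. Qed.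

Lemma factor_mulr1 : right_id factor_one factor_mul.
Proof. by move=> u; rewrite -[u]generic_quotient.reprK factor_piM mulg1. Qed.

Lemma factor_mulV : left_inverse factor_one factor_inv factor_mul.
Proof.
by move=> u; rewrite -[u]generic_quotient.reprK factor_piV factor_piM mulVg.
Qed.

Lemma factor_mulrV : right_inverse factor_one factor_inv factor_mul.
Proof.
by move=> u; rewrite -[u]generic_quotient.reprK factor_piV factor_piM mulgV.
Qed.

HB.instance Definition _ := isGroup.Build factor_group
  factor_mulA factor_mul1 factor_mulr1 factor_mulV factor_mulrV.

End FactorGroup.

Definition isomorphic_groups (G H : groupType) : Prop :=
  exists2 f : G -> H, {morph f : x y / (x * y)%g} & bijective f.

(* N ranges over the normal subgroups of H, H being itself regarded as a group.
   Subgroups are boolean predicates; classically this is no restriction. *)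
Definition involved_in (W G : groupType) : Prop :=
  exists (H : groupClosed G) (N : normalClosed (subgroup_type H)),
    isomorphic_groups (factor_group N) W.

(* The regular wreath product A wr Q: the base group of functions Q -> A, on
   which q acts (on the right, as library actions do) by moving the coordinate
   at x to the coordinate at x * q. *)
Section WreathProduct.

Local Open Scope group_scope.

Variables A Q : finGroupType.

Definition wr_base : finGroupType := {dffun forall _ : Q, A}.

Definition wr_shift (f : wr_base) (q : Q) : wr_base :=
  [ffun x => f (x * q^-1)].

Lemma wr_shift_is_action : is_action [set: Q] wr_shift.
Proof.
split=> [q f1 f2 /ffunP f12|f q r _ _]; apply/ffunP=> x.
  by have := f12 (x * q); rewrite !ffunE mulgK.
by rewrite !ffunE invMg mulgA.
Qed.

Canonical wr_action := Action wr_shift_is_action.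

Lemma wr_shift_is_groupAction : is_groupAction [set: wr_base] wr_action.
Proof.
move=> q _; rewrite inE; apply/andP; split.
  by apply/subsetP=> f; rewrite inE.
apply/morphicP=> f1 f2 _ _; apply/ffunP=> x.
by rewrite !actpermE /= !ffunE.
Qed.

Canonical wr_groupAction := GroupAction wr_shift_is_groupAction.

Definition wreath : finGroupType := sdprod_by wr_groupAction.

End WreathProduct.

(* Main.v *)
(* Some commutator c = [x, y] generates G', and after replacing (x, y) by (y, x)
   or (x, x y) the element y acts on G' by an exponent congruent to 1 mod 4; then
   y permutes the coset x G' in a single cycle of length q = |G'|.  As z is
   central of order 2, (1 + z)^2 = 0, so the 1 + (1 + z) u form an elementary
   abelian group; since z is not in G', the units 1 + (1 + z) x^(y^i), i < q, are
   independent in it.  They generate a base group which y permutes regularly, and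
   dividing its product with <y> by <y^q> gives C_2 wr C_q. *)
Require Import Defs.
From HB Require Import structures.
From mathcomp Require Import all_boot all_order all_fingroup all_algebra.
From mathcomp Require Import all_solvable all_field all_character.
From mathcomp Require Import zify.

Import GRing.Theory.

Local Open Scope group_scope.

(** * Sections as images of partial homomorphisms *)

(* [r] plays the role of a partial homomorphism from G onto W: its domain is the
   subgroup and [r _ 1] the normal subgroup. *)
Lemma involved_in_of_rel (W : finGroupType) (G : groupType) (r : G -> W -> bool)
    (rM : forall v v' w w', r v w -> r v' w' -> r (v * v') (w * w'))
    (rV : forall v w, r v w -> r v^-1 w^-1)
    (r_surj : forall w, exists v, r v w)
    (r1 : forall w, r 1 w -> w = 1) :
  involved_in W G.
Proof.
have r11 : r 1 1 by have [v rv] := r_surj 1; rewrite -(mulgV v) -(mulgV 1) rM ?rV.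
have r_fun v w w' : r v w -> r v w' -> w = w'.
  move=> rw rw'; apply/eqP; rewrite eq_mulgV1; apply/eqP/r1.
  by rewrite -(mulgV v) rM ?rV.
pose Hp : pred G := fun v => [exists w, r v w].
have HpM : mulg_closed Hp.
  move=> u v /existsP[a ra] /existsP[b rb].
  by apply/existsP; exists (a * b); exact: rM.
have HpV : invg_closed Hp.
  by move=> u /existsP[a ra]; apply/existsP; exists a^-1; exact: rV.
have Hp1 : (1 : G) \in Hp by apply/existsP; exists 1.
pose H : groupClosed G := HB.pack Hp (isMulClosed.Build G Hp HpM)
  (isInvClosed.Build G Hp HpV) (isMul1Closed.Build G Hp Hp1).
pose S : groupType := subgroup_type H.
have rS (v : S) : exists w, r (val v) w by apply/existsP; exact: (valP v).
pose Np : pred S := fun v => r (val v) 1.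
have NpM : mulg_closed Np.
  by move=> u v ru rv; rewrite /Np unfold_in -(mulg1 1); exact: rM.
have NpV : invg_closed Np.
  by move=> u ru; rewrite /Np unfold_in -invg1; exact: rV.
have Np1 : (1 : S) \in Np by exact: r11.
have NpJ (x y : S) : x \in Np -> x ^ y \in Np.
  move=> rx; have [w rw] := rS y.
  rewrite /Np unfold_in -(conj1g w) /conjg.
  by apply: (rM); [exact: (rV) | exact: rM].
pose N : normalClosed S := HB.pack Np (isMulClosed.Build S Np NpM)
  (isInvClosed.Build S Np NpV) (isMul1Closed.Build S Np Np1)
  (isConjClosed.Build S Np NpJ).
exists H, N.
(* The default [1] is never taken: [rS] supplies a value, unique by [r_fun]. *)
pose f (u : factor_group N) : W :=
  odflt 1 [pick w | r (val (generic_quotient.repr u)) w].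
have rf u : r (val (generic_quotient.repr u)) (f u).
  rewrite /f; case: pickP => //= nr.
  by have [w] := rS (generic_quotient.repr u); rewrite nr.
have fpi (v : S) w : r (val v) w -> f ((\pi_(factor_group N))%qT v) = w.
  move=> rvw; set u := (\pi_(factor_group N))%qT v.
  have /factor_eqP : (\pi_(factor_group N))%qT (generic_quotient.repr u) = u.
    exact: generic_quotient.reprK.
  rewrite {1}/in_mem /= /Np => rN; apply: (r_fun (val v)) => //.
  move: (rM _ _ _ _ (rf u) rN); rewrite mulg1.
  by rewrite -[val _ * val _]/(val (generic_quotient.repr u *
       ((generic_quotient.repr u)^-1 * v))) mulKVg.
have piE u : u = (\pi_(factor_group N))%qT (generic_quotient.repr u).
  by rewrite generic_quotient.reprK.
exists f.
  move=> u v; rewrite {1}(piE u) {1}(piE v).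
  have -> : (\pi_(factor_group N))%qT (generic_quotient.repr u) *
    (\pi_(factor_group N))%qT (generic_quotient.repr v) =
    (\pi_(factor_group N))%qT (generic_quotient.repr u * generic_quotient.repr v).
    exact: factor_piM.
  by apply: fpi; apply: rM.
have g_ex w : exists v : S, r (val v) w.
  have [v rv] := r_surj w.
  have vH : v \in H by apply/existsP; exists w.
  by exists (Sub v vH).
have [g gP] := fin_all_exists g_ex.
exists (fun w => (\pi_(factor_group N))%qT (g w)) => [u|w]; last exact: fpi.
rewrite [RHS]piE; apply/factor_eqP; rewrite {1}/in_mem /= /Np.
by rewrite -(mulVg (f u)); apply: rM => //; apply: rV.
Qed.

(** * A commutator generating the derived subgroup *)

(* Replacing y by y^2 halves the order of [x, y] because [x, y^2] = [x, y]^(2 j)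
   with j odd; this is where the congruence mod 4 is needed. *)
Lemma commute_expg_order2 (gT : finGroupType) (x y : gT) n k
    (xy_order : #[[~ x, y]] = (2 ^ n)%N) (y2 : 2.-elt y)
    (xyJ : [~ x, y] ^ y = [~ x, y] ^+ (4 * k).+1) m :
  reflect (commute x (y ^+ m)) (2 ^ n %| m).
Proof.
elim: n y k m xy_order y2 xyJ => [|n IHn] y k m xy_order y2 xyJ.
  rewrite expn0 dvd1n; left; apply: commuteX; apply/commgP.
  by rewrite -order_eq1 xy_order.
(* With c = [x, y], [x, y^2] = c c^y = c^(4k+2); the odd factor 2k+1 does not affect the order. *)
have dE : [~ x, y ^+ 2] = [~ x, y] ^+ (2 * (2 * k).+1).
  rewrite (expgS y 1) expg1 commgMJ xyJ -expgS; congr (_ ^+ _); lia.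
have ord2 : #[[~ x, y ^+ 2]] = (2 ^ n)%N.
  rewrite dE expgM orderXgcd orderXdiv xy_order expnS ?dvdn_mulr //.
  rewrite mulKn // (eqP (_ : coprime _ _)) ?divn1 //.
  by rewrite coprimeXl // coprime2n /= oddM.
(* The congruence mod 4 persists: (4k+1)^2 = 4 k (4k+2) + 1. *)
have J2 : [~ x, y ^+ 2] ^ (y ^+ 2) = [~ x, y ^+ 2] ^+ (4 * (k * (4 * k).+2)).+1.
  rewrite dE conjXg (expgS y 1) expg1 conjgM xyJ conjXg xyJ -!expgM; congr (_ ^+ _).
  nia.
have y22 : 2.-elt (y ^+ 2) by exact: p_eltX.
have [m_odd|m_even] := boolP (odd m).
  apply: (iffP idP) => [|cxm].
    by move/(dvdn_trans (dvdn_exp2l 2 (ltn0Sn n))); rewrite dvdn2 m_odd.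
  (* An odd power of the 2-element [y] generates <y>, so [x] would commute with [y], against the
     order 2^(n+1) of [x, y]. *)
  suff /commgP : commute x y.
    rewrite -order_eq1 xy_order => /eqP E; have := expn_gt0 2 n; move: E; rewrite expnS; lia.
  have : y \in <[y ^+ m]>.
    suff /eqP <- : generator <[y]> (y ^+ m) by exact: cycle_id.
    rewrite generator_coprime (pnat_coprime y2) //.
    by rewrite /= p'natE // dvdn2 m_odd.
  by case/cycleP=> i ->; exact: commuteX.
have -> : m = (2 * m./2)%N by rewrite mul2n -[LHS]odd_double_half (negbTE m_even).
rewrite expnS dvdn_pmul2l // expgM; exact: IHn ord2 y22 J2.
Qed.

(** The subgroups of a cyclic p-group form a chain, so a commutator of largest order generates a
    subgroup containing every other commutator. *)
Lemma cyclic_pgroup_commutator (gT : finGroupType) p (G : {group gT})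
    (p_pr : prime p) (pG : p.-group G) (cycG' : cyclic G^`(1)) :
  exists2 x, x \in G & exists2 y, y \in G & G^`(1) = <[ [~ x, y] ]>.
Proof.
have [xy /= Gxy xy_max] : exists2 xy, xy \in setX G G & forall uv, uv \in setX G G ->
    #[[~ uv.1, uv.2]] <= #[[~ xy.1, xy.2]].
  have G1 : (1, 1) \in setX G G by rewrite inE !group1.
  by case: (arg_maxnP (fun uv => #[[~ uv.1, uv.2]]) G1) => xy; exists xy.
case: xy Gxy xy_max => x y /= /setXP[/= Gx Gy] xy_max.
have G'c u v : u \in G -> v \in G -> <[[~ u, v]]> \subset G^`(1).
  by move=> Gu Gv; rewrite cycle_subG mem_commg.
exists x => //; exists y => //; apply/eqP; rewrite eqEsubset G'c // andbT gen_subG.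
apply/subsetP=> _ /imset2P[u v Gu Gv ->]; rewrite -cycle_subG.
rewrite -(cardSg_cyclic cycG') ?G'c // -!orderE.
have pc a b : a \in G -> b \in G -> p.-nat #[[~ a, b]].
  by move=> Ga Gb; apply: mem_p_elt pG _; rewrite groupR.
have uv_le : #[[~ u, v]] <= #[[~ x, y]] by rewrite (xy_max (u, v)) // inE Gu.
by have /p_natP[i Ei] := pc u v Gu Gv; have /p_natP[j Ej] := pc x y Gx Gy;
  move: uv_le; rewrite Ei Ej leq_exp2l ?prime_gt1 //; exact: dvdn_exp2l.
Qed.

(** If y and x act on G' by odd exponents l and k, then x y acts by k l, and one of l, k, k l is 1
    mod 4. The pairs (x, y), (y, x) and (x, x y) have commutators generating the same subgroup. *)
Lemma cyclic_derg_commutator_mod4 (gT : finGroupType) (G : {group gT})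
    (pG : 2.-group G) (cycG' : cyclic G^`(1)) (nabG : ~~ abelian G) :
  exists x y k, [/\ x \in G, y \in G, G^`(1) = <[ [~ x, y] ]>
    & [~ x, y] ^ y = [~ x, y] ^+ (4 * k).+1].
Proof.
have [x Gx [y Gy defG']] := @cyclic_pgroup_commutator _ 2 _ isT pG cycG'.
set c := [~ x, y] in defG'.
have Gc : c \in G by rewrite groupR.
have c_even : 2 %| #[c].
  have := mem_p_elt pG Gc; case/p_natP=> -[|n ->]; last by rewrite expnS dvdn_mulr.
  move/eqP; rewrite order_eq1 => /eqP c1; case/negP: nabG.
  by apply/derG1P; rewrite defG' c1 cycle1.
have cJ g : g \in G -> exists2 k, odd k & c ^ g = c ^+ k.
  move=> Gg; have : c ^ g \in <[c]>.
    by rewrite -defG' memJ_norm ?defG' ?cycle_id // -defG' (subsetP (der_norm 1 G)).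
  case/cycleP=> k ck; exists k => //.
  have: #[c ^ g] = #[c] by rewrite orderJ.
  (* [c] has even order, so its even powers have smaller order, whereas conjugation preserves the
     order. *)
  rewrite ck; apply: contra_eqT; rewrite -dvdn2 => k_even.
  rewrite neq_ltn orderXgcd ltn_Pdiv ?order_gt0 // (@leq_trans 2) // dvdn_leq //.
    by rewrite gcdn_gt0 order_gt0.
  by rewrite dvdn_gcd c_even.
have mod4 k : odd k -> {j | k = (4 * j).+1} + {j | k = (4 * j).+3}.
  move=> k_odd; case E : (odd k./2); [right|left]; exists (k./2)./2; lia.
have [k k_odd xk] := cJ x Gx; have [l l_odd yl] := cJ y Gy.
have [[j jE]|[j jE]] := mod4 l l_odd; first by exists x, y, j; rewrite -jE.
have [[i iE]|[i iE]] := mod4 k k_odd.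
  exists y, x, i; rewrite -(invg_comm x y) conjVg -/c xk iE expVgn.
  by split=> //; rewrite defG' cycleV.
(* Both exponents are 3 mod 4, so that of [x * y] is 1 mod 4. *)
exists x, (x * y), (4 * i * j + 3 * i + 3 * j + 2).
have cE : [~ x, x * y] = c by rewrite commgMJ commgg conj1g mulg1.
rewrite cE; split; rewrite ?groupM // conjgM xk conjXg yl -expgM; congr (_ ^+ _).
by rewrite iE jE; nia.
Qed.

(** * The conjugates of x under powers of y *)

Section WreathSection.

Variables (K : fieldType) (gT Q : finGroupType).
Variables (x y z : gT) (c : Q).
Hypotheses (charK : 2%N \in [pchar K]%R) (pG : 2.-group [set: gT]).
Hypotheses (zZ : z \in 'Z([set: gT])) (z2 : #[z] = 2%N).
Hypotheses (c_gen : [set: Q] = <[c]>) (c_gt1 : (1 < #[c])%N).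
Hypothesis cP : forall m, reflect (commute x (y ^+ m)) (#[c] %| m).
Hypothesis z_notcomm : forall m, [~ x, y ^+ m] != z.

Local Open Scope ring_scope.
Local Notation of_ := (grpAlg_of K).

Let zC g : commute z g.
Proof. by case/centerP: zZ => _; apply; rewrite inE. Qed.

Lemma expg_log_ex : exists e : Q -> nat, forall t, t = (c ^+ e t)%g.
Proof.
apply: (fin_all_exists (P := fun t m => t = (c ^+ m)%g)) => t.
by apply/cycleP; rewrite -c_gen inE.
Qed.

Lemma conj_expg_eq m n :
  (x ^ (y ^+ m) == x ^ (y ^+ n))%g = (m == n %[mod #[c]])%N.
Proof.
wlog le_nm : m n / (n <= m)%N => [IH|].
  by case/orP: (leq_total n m) => /IH // E; rewrite eq_sym E eq_sym.
rewrite -{1}(subnK le_nm) expgD conjgM (inj_eq (conjg_inj _)) conjg_fix.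
rewrite eqn_mod_dvd //; exact: (sameP commgP (cP _)).
Qed.

(* [e] is a discrete logarithm to the base [c]. *)
Variable e : Q -> nat.
Hypothesis eE : forall t, t = (c ^+ e t)%g.

(** Indexing the conjugates by [Q] turns conjugation by [y] into right translation by [c], the
    regular action. *)
Definition theta (t : Q) : gT := (x ^ (y ^+ e t))%g.

Lemma thetaJ t m : (theta t ^ (y ^+ m))%g = theta (t * c ^+ m)%g.
Proof.
rewrite /theta -conjgM -expgD; apply/eqP; rewrite conj_expg_eq.
by rewrite -eq_expg_mod_order expgD -!eE.
Qed.

Lemma theta_inj : injective theta.
Proof.
move=> s t /eqP; rewrite conj_expg_eq -eq_expg_mod_order -!eE.
by move/eqP.
Qed.

(** If a conjugate of [x] were 1 (or [z], in the next lemma), [x] would be central, and [cP] at m =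
    1 would force #[c] = 1. *)
Lemma theta_neq1 t : theta t != 1%g.
Proof.
rewrite /theta conjg_eq1; apply: contraTneq c_gt1 => x1.
by rewrite -leqNgt dvdn_leq //; apply/cP; rewrite x1; apply/commute_sym; exact: commute1.
Qed.

Lemma theta_neqz t : theta t != z.
Proof.
rewrite /theta -(inj_eq (conjg_inj (y ^+ e t)^-1)%g) conjgK.
rewrite (conjg_fixP (_ : [~ z, _] == 1)%g); last exact/commgP/zC.
apply: contraTneq c_gt1 => xz.
by rewrite -leqNgt dvdn_leq //; apply/cP; rewrite xz; exact: zC.
Qed.

(** Equality would make [z] a commutator [x, y^m], with m a difference of discrete logarithms. *)
Lemma z_theta_neq s t : (z * theta s)%g != theta t.
Proof.
have zJ g : (z ^ g)%g = z by apply/conjg_fixP/commgP/zC.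
(* Since z^2 = 1, the excluded equation is symmetric in [s] and [t]. *)
wlog le_st : s t / (e s <= e t)%N => [IH|].
  case/orP: (leq_total (e s) (e t)) => [/IH//|/IH]; apply: contraNneq => <-.
  by rewrite mulgA -expg2 -z2 expg_order mul1g.
rewrite /theta -(subnK le_st) expgD conjgM -{1}(zJ (y ^+ e s)%g) -conjMg.
rewrite (inj_eq (conjg_inj _)); apply: contra_neq (z_notcomm (e t - e s)) => E.
by rewrite commgEl -E zC mulKg.
Qed.

(** * The base group of units *)

Lemma grpAlg_of_mulE (g h : gT) (u : grpAlg K gT) : (of_ g * u) h = u (g^-1 * h)%g.
Proof.
rewrite mulgE (bigD1 g) //= big1 => [|k /negbTE kg].
  by rewrite ffunE eqxx mul1r addr0.
by rewrite ffunE kg mul0r.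
Qed.

Definition wr_coef (s : wr_base 'Z_2 Q) : grpAlg K gT :=
  \sum_(t : Q) ((s t : nat)%:R : K) *: of_ (theta t).

(** As z is central and (1 + z)^2 = 0, this is the expanded product of the units 1 + (1 + z)
    [theta t] over the [t] with [s t] = 1. *)
Definition wr_unit (s : wr_base 'Z_2 Q) : grpAlg K gT :=
  1 + (1 + of_ z) * wr_coef s.

Lemma natr_Z2M (a b : 'Z_2) : ((a * b)%g : nat)%:R = (a : nat)%:R + (b : nat)%:R :> K.
Proof. by rewrite -natrD (GRing.natr_mod_pchar charK). Qed.

Lemma wr_coefM s t : wr_coef (s * t)%g = wr_coef s + wr_coef t.
Proof.
rewrite /wr_coef -big_split; apply: eq_bigr => q _ /=.
by rewrite mulg_ffun natr_Z2M scalerDl.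
Qed.

Lemma grpAlg_addxx (u : grpAlg K gT) : u + u = 0.
Proof. by apply/ffunP=> g; rewrite !ffunE (addrr_pchar2 charK). Qed.

Lemma of_zC u : of_ z * u = u * of_ z.
Proof.
rewrite [u]grpAlg_sum mulr_suml mulr_sumr; apply: eq_bigr => g _.
by rewrite -scalerAl -scalerAr -!grpAlg_ofM zC.
Qed.

Lemma sqr_1Dz : (1 + of_ z) * (1 + of_ z) = 0.
Proof.
rewrite mulrDl mul1r mulrDr mulr1 -grpAlg_ofM -expg2 -z2 expg_order grpAlg_of1.
by rewrite [of_ z + 1]addrC grpAlg_addxx.
Qed.

Lemma wr_unitM s t : wr_unit (s * t)%g = wr_unit s * wr_unit t.
Proof.
have aC u : (1 + of_ z) * u = u * (1 + of_ z).
  by rewrite mulrDl mulrDr mul1r mulr1 of_zC.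
rewrite /wr_unit wr_coefM; move: (1 + of_ z) aC sqr_1Dz => a aC a2.
have -> : (1 + a * wr_coef s) * (1 + a * wr_coef t) =
    1 + a * wr_coef t + (a * wr_coef s + a * wr_coef s * (a * wr_coef t)).
  by rewrite mulrDl mul1r mulrDr mulr1.
(* The cross term contains (1 + z)^2. *)
rewrite {2}(aC (wr_coef s)) -(mulrA (wr_coef s)) (mulrA a a) a2 mul0r mulr0 addr0.
by rewrite mulrDr -addrA [a * wr_coef s + _]addrC.
Qed.

Lemma wr_unit1 : wr_unit 1%g = 1.
Proof.
rewrite /wr_unit /wr_coef big1 ?mulr0 ?addr0 // => t _.
by rewrite oneg_ffun scale0r.
Qed.

(** This mirrors the semidirect product, where a base element passes an element of [Q] by being
    shifted. *)
Lemma wr_unitJ s m : wr_unit s * of_ (y ^+ m)%g =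
  of_ (y ^+ m)%g * wr_unit (wr_shift s (c ^+ m)%g).
Proof.
rewrite /wr_unit mulrDl mulrDr mul1r mulr1; congr (_ + _).
have -> : of_ (y ^+ m)%g * ((1 + of_ z) * wr_coef (wr_shift s (c ^+ m)%g)) =
  (1 + of_ z) * (of_ (y ^+ m)%g * wr_coef (wr_shift s (c ^+ m)%g)).
  by rewrite !mulrDl mulrDr !mul1r mulrA -of_zC -mulrA.
rewrite -mulrA; congr (_ * _); rewrite mulr_suml mulr_sumr.
rewrite [RHS](reindex_inj (mulIg (c ^+ m)%g)) /=; apply: eq_bigr => t _.
by rewrite -scalerAl -scalerAr ffunE mulgK -!grpAlg_ofM -thetaJ -conjgC.
Qed.

Lemma wr_unit_aug s : augmentation (wr_unit s) = 1.
Proof.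
rewrite /wr_unit linearD /= augmentationM linearD /= !augmentation1.
by rewrite augmentation_of (addrr_pchar2 charK) mul0r addr0.
Qed.

Lemma wr_coefE s g :
  wr_coef s g = \sum_(t : Q) ((s t : nat)%:R : K) * (g == theta t)%:R.
Proof. by rewrite sum_ffunE; apply: eq_bigr => t _; rewrite !ffunE. Qed.

(** No [theta t] is 1 or z, and none is z times another, so the coefficient at 1 determines [g] and
    the one at [theta t] reads off [s t]. Thus the units are independent and meet G trivially. *)
Lemma wr_unit_grp s g : wr_unit s = of_ g -> g = 1%g /\ s = 1%g.
Proof.
move=> sg; have zV : (z^-1 = z)%g by apply/eqP; rewrite eq_invg_mul -expg2 -z2 expg_order.
(* Comparison of the coefficients of [h] in [sg], first for h = 1, then h = theta t. *)
have sgE h : (h == 1%g)%:R + (wr_coef s h + wr_coef s (z * h)%g) = (h == g)%:R :> K.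
  move/ffunP/(_ h): sg; rewrite /wr_unit mulrDl mul1r !addgE grpAlg_of_mulE zV.
  by rewrite !ffunE.
have g1 : g = 1%g.
  have := sgE 1%g; rewrite eqxx mulg1 !wr_coefE !big1 ?addr0.
  - by case: eqP => // _ /eqP; rewrite oner_eq0.
  - by move=> t _; rewrite eq_sym (negbTE (theta_neqz t)) mulr0.
  - by move=> t _; rewrite eq_sym (negbTE (theta_neq1 t)) mulr0.
split=> //; apply/ffunP=> t; rewrite ffunE.
have := sgE (theta t); rewrite g1 (negbTE (theta_neq1 t)) add0r !wr_coefE.
rewrite (bigD1 t) //= eqxx mulr1 !big1 ?addr0.
- by case: (s t) => [[|[|//]] lt_i] /= => [_|/eqP]; [exact: val_inj | rewrite oner_eq0].
- by move=> u _; rewrite (negbTE (z_theta_neq _ _)) mulr0.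
- by move=> u ut; rewrite (inj_eq theta_inj) eq_sym (negbTE ut) mulr0.
Qed.

(** * The map onto the wreath product *)

Definition wr_rel (v : normUnit K gT) (w : wreath 'Z_2 Q) : bool :=
  [exists m : 'I_#[y], (val v == of_ (y ^+ m)%g * wr_unit w.2) && (w.1 == c ^+ m)%g].

(** Reducing [m] modulo #[y] is harmless: y^#[y] = 1 commutes with [x], so #[c] divides #[y]. *)
Lemma wr_relP v (w : wreath 'Z_2 Q) :
  reflect (exists2 m, val v = of_ (y ^+ m)%g * wr_unit w.2 & w.1 = (c ^+ m)%g)
    (wr_rel v w).
Proof.
apply: (iffP existsP) => [[m /andP[/eqP vE /eqP wE]]|[m vE wE]]; first by exists m.
exists (Ordinal (ltn_pmod m (order_gt0 y))); rewrite /= expg_mod_order -vE eqxx /=.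
rewrite wE expg_mod //; apply/eqP; rewrite -order_dvdn; apply/cP.
by rewrite expg_order; exact: commute1.
Qed.

(** The element y^m [wr_unit s] goes to (c^m, s), and the kernel is generated by y^#[c]. *)
Lemma wreath_involved_in : involved_in (wreath 'Z_2 Q) (normUnit K gT).
Proof.
have relM v v' w w' : wr_rel v w -> wr_rel v' w' -> wr_rel (v * v')%g (w * w')%g.
  case/wr_relP=> m vE wE /wr_relP[m' vE' wE']; apply/wr_relP; exists (m + m')%N.
    rewrite [val _]/= vE vE' /= wr_unitM wE' expgD grpAlg_ofM.
    by rewrite -!mulrA; congr (_ * _); rewrite !mulrA wr_unitJ.
  by rewrite /= wE wE' expgD.
have rel_surj w : exists v, wr_rel v w.
  have wP : normUnit_pred (of_ (y ^+ e w.1)%g * wr_unit w.2).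
    rewrite (normUnit_pred_pgroup charK pG) mem_augIdeal linearB /= augmentation1.
    by rewrite augmentationM augmentation_of wr_unit_aug mul1r subrr.
  by exists (Sub _ wP); apply/wr_relP; exists (e w.1).
have rel1 w : wr_rel 1%g w -> w = 1%g.
  case/wr_relP=> m /= vE wE.
  have /wr_unit_grp[ym w21] : wr_unit w.2 = of_ (y ^+ m)^-1%g.
    by rewrite -[LHS]mul1r -grpAlg_of1 -(mulVg (y ^+ m)%g) grpAlg_ofM -mulrA -vE mulr1.
  apply: val_inj; rewrite [val _]surjective_pairing wE w21; congr (_, _).
  apply/eqP; rewrite -order_dvdn; apply/cP.
  by rewrite -[(y ^+ m)%g]invgK ym invg1; exact: commute1.
apply: (involved_in_of_rel _ _ wr_rel relM _ rel_surj rel1) => v w vw.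
(* With [u] over w^-1, the product v u lies over 1, so it is some y^m with c^m = 1 and its inverse
   also lies over 1; then v^-1 = u (v u)^-1. *)
have [u uw] := rel_surj w^-1%g.
have vu := relM _ _ _ _ vw uw; rewrite mulgV in vu.
have /wr_relP[m /= vuE cm] := vu.
have vuV : wr_rel (v * u)^-1%g 1%g.
  (* A natural exponent that represents -m modulo #[y]. *)
  apply/wr_relP; exists (m * #[y].-1)%N; last by rewrite expgM -cm expg1n.
  rewrite wr_unit1 mulr1 in vuE; rewrite wr_unit1 mulr1.
  apply: (@mulrI _ (val (v * u)%g)); first exact: normUnit_unit.
  rewrite -[LHS]/(val ((v * u) * (v * u)^-1))%g mulgV [X in X * _]vuE -grpAlg_ofM -expgD.
  rewrite -mulnS prednK // mulnC expgM expg_order expg1n; exact: grpAlg_of1.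
rewrite -[w^-1%g]mulg1 -[v^-1%g](mulKVg u) -invMg; exact: relM.
Qed.

End WreathSection.

(** * The derived subgroup as the acting group *)

Theorem mainTheorem1 (K : fieldType) (gT : finGroupType)
    (charK : 2%N \in [pchar K]%R)
    (pG : 2.-group [set: gT])
    (nabG : ~~ abelian [set: gT])
    (cycG' : cyclic [set: gT]^`(1))
    (exz : exists2 z : gT,
       z \in 'Z([set: gT]) :\: [set: gT]^`(1) & #[z] = 2%N) :
  involved_in (wreath 'Z_2 [subg [set: gT]^`(1)]%type) (normUnit K gT).
Proof.
have [z zP z2] := exz; have /setDP[zZ zG'] := zP.
have [x [y [k [_ _ defG' xyJ]]]] := @cyclic_derg_commutator_mod4 _ [set: gT]%G pG cycG' nabG.
set c0 := [~ x, y] in defG' xyJ.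
have y2 : 2.-elt y by apply: mem_p_elt pG _; rewrite inE.
have c2 : 2.-elt c0 by apply: mem_p_elt pG _; rewrite inE.
have /p_natP[n cn] := c2.
have G'c0 : c0 \in [set: gT]^`(1) by rewrite defG' cycle_id.
(* The acting group is G' as a type of its own, so the generator [c0] is transported there. *)
pose c := subg [set: gT]^`(1)%G c0.
have c_gen : [set: [subg [set: gT]^`(1)]%type] = <[c]>.
  apply/setP=> t; rewrite inE; apply/esym.
  have /cycleP[i tE] : sgval t \in <[c0]> by rewrite -defG' subgP.
  apply/cycleP; exists i.
  by rewrite -[t]sgvalK tE morphX.
have c_order : #[c] = #[c0].
  by rewrite [LHS](order_injm (injm_subg _)).
have cP m : reflect (commute x (y ^+ m)) (#[c] %| m).
  by rewrite c_order cn; exact: (commute_expg_order2 _ _ _ _ _ cn y2 xyJ).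
have c_gt1 : 1 < #[c].
  rewrite c_order order_gt1; apply: contra nabG => /eqP c1.
  by apply/derG1P; rewrite defG' c1 cycle1.
have zc m : [~ x, y ^+ m] != z.
  by apply: contraNneq zG' => <-; rewrite mem_commg ?inE.
have [e eE] := expg_log_ex _ _ c_gen.
exact: (wreath_involved_in _ _ _ _ _ _ _ charK pG zZ z2 c_gt1 cP zc e eE).
Qed.
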